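(* Let $H\in\mathcal A$ and define $$R_H=H-(2x-2xS^{-1}).$$ There exists $E\in\mathcal A$ such that $(E,H,1-S)$ is an $\mathfrak{sl}_2$-triple if and only if $R_H\in\mathbb K[S,S^{-1}]$. When this holds, writing $R_H=R_H(S)$ and letting $R_H(1)\in\mathbb K$ denote its value at $S=1$, the parameters $\lambda\in\mathbb K$ and $g\in\mathbb K[S,S^{-1}]$ for which $H=2(xS^{-1}+g(S))(S-1)-\lambda$, and the raising operator $E$, are recovered uniquely by $$\lambda=-R_H(1),\qquad g(S)=\frac{R_H(S)-R_H(1)}{2(S-1)},$$ $$E=\bigl(xS^{-1}+g(S)\bigr)^2(S-1)-\lambda\bigl(xS^{-1}+g(S)\bigr).$$
   Context: $\mathbb K$ is a field of characteristic zero. $\mathcal A=\mathbb K[x]\langle S,S^{-1}\rangle/(Sx-(x+1)S)$ is the algebra of finite sums $\sum_j t_j(x)S^j$, $j\in\mathbb Z$, $t_j(x)\in\mathbb K[x]$, with $Sx=(x+1)S$. The subring $\mathbb K[S,S^{-1}]\subset\mathcal A$ consists of the operators with constant coefficients. An $\mathfrak{sl}_2$-triple $(E,H,F)$ satisfies $[H,E]=2E$, $[H,F]=-2F$, $[E,F]=H$. *)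

(* Defs.v *)
From HB Require Import structures.
From mathcomp Require Import all_boot all_order all_algebra.
From mathcomp Require Import finmap.
From mathcomp.multinomials Require Import monalg.

Set Implicit Arguments.
Unset Strict Implicit.
Unset Printing Implicit Defensive.

Import GRing.Theory.

Local Open Scope ring_scope.

Section Sl2.
Variable R : pzRingType.
Implicit Types a b E H F : R.

Definition bracket a b : R := a * b - b * a.

Definition sl2_triple E H F : Prop :=
  [/\ bracket H E = E *+ 2, bracket H F = - (F *+ 2) & bracket E F = H].

End Sl2.

Section ShiftPoly.
Variable K : fieldType.
Implicit Types (p q : {poly K}) (i j : int) (c : K).

Definition shiftp i p : {poly K} := p \Po ('X + (i%:~R)%:P).

Lemma shiftpD i : {morph shiftp i : p q / p + q}.
Proof. by move=> p q; rewrite /shiftp comp_polyD. Qed.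

Lemma shiftpM i : {morph shiftp i : p q / p * q}.
Proof. by move=> p q; rewrite /shiftp comp_polyM. Qed.

Lemma shiftpC i c : shiftp i c%:P = c%:P.
Proof. by rewrite /shiftp comp_polyC. Qed.

Lemma shiftp0 i : shiftp i 0 = 0.
Proof. exact: shiftpC. Qed.

Lemma shift0p p : shiftp 0 p = p.
Proof. by rewrite /shiftp addr0 comp_polyXr. Qed.

Lemma shiftpX i : shiftp i 'X = 'X + (i%:~R)%:P.
Proof. by rewrite /shiftp comp_polyX. Qed.

Lemma shiftp_shiftp i j p : shiftp i (shiftp j p) = shiftp (i + j) p.
Proof.
rewrite /shiftp -comp_polyA comp_polyD comp_polyX comp_polyC.
by rewrite -addrA -polyCD intrD.
Qed.

End ShiftPoly.

(* The element \sum_j t_j(x) S^j is represented by the finitely supported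
   family (t_j); the product is the one forced by S^i t(x) = t(x + i) S^i,
   not the (untwisted) product of a monoid algebra. *)
Definition shiftalg (K : fieldType) := {malg {poly K}[int]}.

Section ShiftAlgebra.
Variable K : fieldType.
Local Notation A := (shiftalg K).
Implicit Types (u v w : A) (p q : {poly K}) (i j : int) (c : K).

HB.instance Definition _ := GRing.Zmodule.copy A {malg {poly K}[int]}.

Definition shiftalg_one : A := << 1 *g 0%R >>.

Definition shiftalg_mul u v : A :=
  \sum_(i <- msupp u) \sum_(j <- msupp v)
    << u@_i * shiftp i v@_j *g (i + j)%R >>.

Definition shiftalg_scale c u : A := (c%:P *: (u : {malg {poly K}[int]}))%R.

Local Notation mul := shiftalg_mul.

Fact shiftalg_mulw (d1 d2 : {fset int}) u v :
  (msupp u `<=` d1)%fset -> (msupp v `<=` d2)%fset ->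
  mul u v = \sum_(i <- d1) \sum_(j <- d2) << u@_i * shiftp i v@_j *g (i + j)%R >>.
Proof.
move=> le1 le2; rewrite /mul (big_fset_incl _ le1) /=.
  apply: eq_bigr => i _; apply: (big_fset_incl _ le2) => j _ /mcoeff_outdom ->.
  by rewrite shiftp0 mulr0 monalgU0.
move=> i _ /mcoeff_outdom ui; rewrite big1 // => j _.
by rewrite ui mul0r monalgU0.
Qed.

Fact shiftalg_mulDl : left_distributive mul +%R.
Proof.
move=> u v w; have s := fsubset_refl (msupp w).
rewrite (shiftalg_mulw (msuppD_le u v) s).
rewrite (shiftalg_mulw (fsubsetUl (msupp u) (msupp v)) s).
rewrite (shiftalg_mulw (fsubsetUr (msupp u) (msupp v)) s).
rewrite -big_split /=; apply: eq_bigr => i _.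
rewrite -big_split /=; apply: eq_bigr => j _.
by rewrite mcoeffD mulrDl monalgUD.
Qed.

Fact shiftalg_mulDr : right_distributive mul +%R.
Proof.
move=> w u v; have s := fsubset_refl (msupp w).
rewrite (shiftalg_mulw s (msuppD_le u v)).
rewrite (shiftalg_mulw s (fsubsetUl (msupp u) (msupp v))).
rewrite (shiftalg_mulw s (fsubsetUr (msupp u) (msupp v))).
rewrite -big_split /=; apply: eq_bigr => i _.
rewrite -big_split /=; apply: eq_bigr => j _.
by rewrite mcoeffD shiftpD mulrDr monalgUD.
Qed.

Fact shiftalg_mul0 : left_zero 0 mul.
Proof. by move=> u; rewrite /mul msupp0 big_seq_fset0. Qed.

Fact shiftalg_mulr0 : right_zero 0 mul.
Proof.
by move=> u; rewrite /mul big1 // => i _; rewrite msupp0 big_seq_fset0.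
Qed.

Fact shiftalg_mulUU p q i j :
  mul << p *g i >> << q *g j >> = << p * shiftp i q *g (i + j)%R >>.
Proof.
by rewrite (shiftalg_mulw msuppU_le msuppU_le) !big_seq_fset1 !mcoeffUU.
Qed.

Fact shiftalg_ind (P : A -> Prop) :
  P 0 -> (forall u v, P u -> P v -> P (u + v)) ->
  (forall p i, P << p *g i >>) -> forall u, P u.
Proof. by move=> P0 PD PU u; rewrite [u]monalgE; apply: big_ind. Qed.

Fact shiftalg_mulA : associative mul.
Proof.
move=> u v w; elim/shiftalg_ind: u => [|u1 u2 IH1 IH2|p i].
- by rewrite !shiftalg_mul0.
- by rewrite !shiftalg_mulDl IH1 IH2.
elim/shiftalg_ind: v => [|v1 v2 IH1 IH2|q j].
- by rewrite shiftalg_mulr0 !shiftalg_mul0 shiftalg_mulr0.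
- by rewrite shiftalg_mulDr !shiftalg_mulDl shiftalg_mulDr IH1 IH2.
elim/shiftalg_ind: w => [|w1 w2 IH1 IH2|r k].
- by rewrite !shiftalg_mulr0.
- by rewrite !shiftalg_mulDr IH1 IH2.
by rewrite !shiftalg_mulUU shiftpM shiftp_shiftp mulrA addrA.
Qed.

Fact shiftalg_mul1 : left_id shiftalg_one mul.
Proof.
elim/shiftalg_ind=> [|u v IHu IHv|p i]; first by rewrite shiftalg_mulr0.
  by rewrite shiftalg_mulDr IHu IHv.
by rewrite shiftalg_mulUU shift0p mul1r add0r.
Qed.

Fact shiftalg_mulr1 : right_id shiftalg_one mul.
Proof.
elim/shiftalg_ind=> [|u v IHu IHv|p i]; first by rewrite shiftalg_mul0.
  by rewrite shiftalg_mulDl IHu IHv.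
by rewrite shiftalg_mulUU -polyC1 shiftpC polyC1 mulr1 addr0.
Qed.

Fact shiftalg_one_neq0 : shiftalg_one != 0.
Proof. by rewrite monalgU_eq0 oner_eq0. Qed.

HB.instance Definition _ := GRing.Zmodule_isNzRing.Build A
  shiftalg_mulA shiftalg_mul1 shiftalg_mulr1 shiftalg_mulDl shiftalg_mulDr
  shiftalg_one_neq0.

Fact shiftalg_scaleE c u j : (shiftalg_scale c u)@_j = c%:P * u@_j.
Proof. exact: mcoeffZ. Qed.

Fact shiftalg_scaleA c d u :
  shiftalg_scale c (shiftalg_scale d u) = shiftalg_scale (c * d) u.
Proof. by rewrite /shiftalg_scale scalerA polyCM. Qed.

Fact shiftalg_scale1 : left_id 1 shiftalg_scale.
Proof. by move=> u; rewrite /shiftalg_scale polyC1 scale1r. Qed.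

Fact shiftalg_scaleDr : right_distributive shiftalg_scale +%R.
Proof. by move=> c u v; rewrite /shiftalg_scale scalerDr. Qed.

Fact shiftalg_scaleDl u : {morph shiftalg_scale^~ u : c d / c + d}.
Proof. by move=> c d; rewrite /shiftalg_scale polyCD scalerDl. Qed.

HB.instance Definition _ := GRing.Zmodule_isLmodule.Build K A
  shiftalg_scaleA shiftalg_scale1 shiftalg_scaleDr shiftalg_scaleDl.

Lemma shiftalg_mcoeffZ c u j : (c *: u)@_j = c%:P * u@_j.
Proof. exact: shiftalg_scaleE. Qed.

Lemma shiftalg_scaleU c p j : c *: (<< p *g j >> : A) = << c%:P * p *g j >>.
Proof.
apply/malgP => k; rewrite shiftalg_mcoeffZ !mcoeffU.
by rewrite mulrnAr.
Qed.

Lemma shiftalg_mulE u v : u * v = shiftalg_mul u v.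
Proof. by []. Qed.

Lemma shiftalgUU p q i j :
  (<< p *g i >> : A) * << q *g j >> = << p * shiftp i q *g (i + j)%R >>.
Proof. exact: shiftalg_mulUU. Qed.

Lemma shiftalg_sumU u : u = \sum_(i <- msupp u) (<< u@_i *g i >> : A).
Proof. exact: monalgE. Qed.

Fact shiftalg_scaleAl c u v : c *: (u * v) = (c *: u) * v.
Proof.
elim/shiftalg_ind: u => [|u1 u2 IH1 IH2|p i].
- by rewrite scaler0 !mul0r scaler0.
- by rewrite mulrDl !scalerDr mulrDl IH1 IH2.
elim/shiftalg_ind: v => [|v1 v2 IH1 IH2|q j].
- by rewrite !mulr0 scaler0.
- by rewrite !mulrDr scalerDr IH1 IH2.
by rewrite shiftalg_scaleU !shiftalgUU shiftalg_scaleU mulrA.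
Qed.

HB.instance Definition _ := GRing.Lmodule_isLalgebra.Build K A shiftalg_scaleAl.

Fact shiftalg_scaleAr c u v : c *: (u * v) = u * (c *: v).
Proof.
elim/shiftalg_ind: u => [|u1 u2 IH1 IH2|p i].
- by rewrite !mul0r scaler0.
- by rewrite !mulrDl scalerDr IH1 IH2.
elim/shiftalg_ind: v => [|v1 v2 IH1 IH2|q j].
- by rewrite scaler0 !mulr0 scaler0.
- by rewrite mulrDr !scalerDr mulrDr IH1 IH2.
by rewrite shiftalg_scaleU !shiftalgUU shiftalg_scaleU shiftpM shiftpC mulrCA.
Qed.

HB.instance Definition _ := GRing.Lalgebra_isAlgebra.Build K A shiftalg_scaleAr.

Definition polyA p : A := << p *g 0%R >>.
Definition SpowA j : A := << 1 *g j >>.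

Lemma polyA_is_zmod_morphism : zmod_morphism polyA.
Proof. by move=> p q; rewrite /polyA monalgUB. Qed.

Lemma polyA_is_monoid_morphism : monoid_morphism polyA.
Proof. by split=> // p q; rewrite shiftalgUU shift0p addr0. Qed.

HB.instance Definition _ :=
  GRing.isZmodMorphism.Build {poly K} A polyA polyA_is_zmod_morphism.
HB.instance Definition _ :=
  GRing.isMonoidMorphism.Build {poly K} A polyA polyA_is_monoid_morphism.

Lemma polyAC c : polyA c%:P = c%:A.
Proof. by rewrite shiftalg_scaleU mulr1. Qed.

Lemma SpowA0 : SpowA 0 = 1.
Proof. by []. Qed.

Lemma SpowAD i j : SpowA (i + j) = SpowA i * SpowA j.
Proof. by rewrite shiftalgUU -polyC1 shiftpC mulr1. Qed.

Lemma SpowA_polyA i p : SpowA i * polyA p = polyA (shiftp i p) * SpowA i.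
Proof.
rewrite !shiftalgUU -{2}polyC1 shiftpC mul1r mulr1.
by rewrite addr0 add0r.
Qed.

Lemma shiftalgE u : u = \sum_(j <- msupp u) polyA u@_j * SpowA j.
Proof.
rewrite {1}[u]shiftalg_sumU; apply: eq_bigr => j _.
by rewrite shiftalgUU -polyC1 shiftpC mulr1 add0r.
Qed.

Definition xA : A := polyA 'X.
Definition SA : A := SpowA 1.
Definition SVA : A := SpowA (-1).

Lemma SA_xA : SA * xA = (xA + 1) * SA.
Proof. by rewrite SpowA_polyA shiftpX polyC1 rmorphD rmorph1. Qed.

Lemma SA_SVA : SA * SVA = 1.
Proof. by rewrite -SpowAD subrr. Qed.

Lemma SVA_SA : SVA * SA = 1.
Proof. by rewrite -SpowAD addNr. Qed.

(* K[S, S^-1], as a subset of A. *)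
Definition const_op_pred u := all (fun j => (size u@_j <= 1)%N) (msupp u).
Definition const_op := [qualify a u | const_op_pred u].

Lemma const_opP u :
  reflect (forall j, exists c, u@_j = c%:P) (u \is a const_op).
Proof.
apply: (iffP allP) => [h j | h j _]; last first.
  by have [c ->] := h j; rewrite size_polyC leq_b1.
have [/h uj | _] := msuppP u j; last by exists 0.
by exists u@_j`_0; apply: size1_polyC.
Qed.

Fact const_op_subring : subring_closed const_op.
Proof.
have cB : {in const_op &, forall u v, u - v \is a const_op}.
  move=> u v /const_opP hu /const_opP hv; apply/const_opP => j.
  have [[c uj] [d vj]] := (hu j, hv j).
  by exists (c - d); rewrite mcoeffB uj vj polyCB.
have c0 : (0 : A) \is a const_op.
  by apply/const_opP => j; exists 0; rewrite mcoeff0.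
have cD : {in const_op &, forall u v, u + v \is a const_op}.
  by move=> u v hu hv; rewrite -[v]opprK cB // -[- v]sub0r cB.
split=> // [|u v /const_opP hu /const_opP hv].
  apply/const_opP => j; exists (0 == j)%:R.
  by rewrite mcoeffU; case: eqP.
rewrite /= shiftalg_mulE /shiftalg_mul.
apply: (big_ind (fun w : A => w \is a const_op)) => // i _.
apply: (big_ind (fun w : A => w \is a const_op)) => // j _.
have [[c ->] [d ->]] := (hu i, hv j).
apply/const_opP => k; exists (c * d *+ (i + j == k)).
by rewrite mcoeffU shiftpC -polyCM polyCMn.
Qed.

HB.instance Definition _ :=
  GRing.isSubringClosed.Build A const_op_pred const_op_subring.

(* \sum_j c_j S^j |-> \sum_j c_j s^j ; only meaningful on const_op. *)
Definition evalS (s : K) u : K := mmap (coefp 0) (fun j => s ^ j) u.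

(* q = n / d in K[S, S^-1], as an exact quotient. *)
Definition const_op_quotient (n d q : A) : Prop :=
  unique (fun r => r \is a const_op /\ r * d = n) q.

End ShiftAlgebra.

Arguments polyA {K} p.
Arguments SpowA {K} j.
Arguments xA {K}.
Arguments SA {K}.
Arguments SVA {K}.
Arguments const_op {K}.

(* Main.v *)
Require Import Defs.
From HB Require Import structures.
From mathcomp Require Import all_boot all_order all_algebra.
From mathcomp Require Import finmap zify.
From mathcomp.multinomials Require Import monalg.

Import GRing.Theory.
Local Open Scope ring_scope.

(* In characteristic zero the centralizer of S is K[S, S^-1]. Since [2x - 2x
   S^-1, F] = -2F, the relation [H, F] = -2F says exactly that R_H commutes
   with S. Conversely, B = xS^-1 + g(S) and T = S - 1 satisfy TB - BT = 1, and
   the triple is the Weyl-algebra one: H = 2BT - lambda, E = B^2 T - lambda B,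
   F = -T. Two raising operators differ by some D in K[S, S^-1] with
   [H, D] = 2D, i.e. (j + 1)(d_(j+1) - d_j) = 0 for its coefficients d_j, and
   finiteness of the support forces D = 0. *)

(** * Commutator identities and the Weyl-algebra triple *)

Lemma bracketMr (R : pzRingType) (a b c : R) :
  bracket a (b * c) = bracket a b * c + b * bracket a c.
Proof. by rewrite /bracket mulrBl mulrBr !mulrA addrA subrK. Qed.

Lemma bracketMl (R : pzRingType) (a b c : R) :
  bracket (a * b) c = a * bracket b c + bracket a c * b.
Proof. by rewrite /bracket mulrBl mulrBr !mulrA addrA subrK. Qed.

Lemma bracketBl (R : pzRingType) (a b c : R) :
  bracket (a - b) c = bracket a c - bracket b c.
Proof.
by rewrite /bracket mulrBl mulrBr !opprB addrACA [RHS]addrACA [- _ + _]addrC.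
Qed.

Lemma bracketDr (R : pzRingType) (a b c : R) :
  bracket a (b + c) = bracket a b + bracket a c.
Proof. by rewrite /bracket mulrDl mulrDr opprD addrACA. Qed.

Lemma bracketBr (R : pzRingType) (a b c : R) :
  bracket a (b - c) = bracket a b - bracket a c.
Proof.
by rewrite /bracket mulrBl mulrBr !opprB addrACA [RHS]addrACA [- _ + _]addrC.
Qed.

Lemma bracketMnl (R : pzRingType) (a b : R) n :
  bracket (a *+ n) b = bracket a b *+ n.
Proof. by rewrite /bracket mulrnBl mulrnAl mulrnAr. Qed.

Lemma bracketC (R : pzRingType) (a b : R) : bracket a b = - bracket b a.
Proof. by rewrite /bracket opprB. Qed.

Lemma bracketN (R : pzRingType) (a b : R) : bracket a (- b) = bracket b a.
Proof. by rewrite /bracket mulrN mulNr opprK addrC. Qed.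

Lemma bracket_eq0 (R : pzRingType) (a b : R) :
  GRing.comm a b <-> bracket a b = 0.
Proof. by rewrite /bracket; split=> [->|/subr0_eq]; rewrite ?subrr. Qed.

(** The bracket with [B * T] fixes [B] and negates [T], so [B] has weight 1 and [T] weight -1;
    doubling gives the weights 2 and -2, and the central [l] drops out. The last relation is
    [T, B^2] T - l [T, B] = 2BT - l. *)
Lemma weyl_sl2_triple (R : pzRingType) (B T l : R) :
  bracket T B = 1 -> (forall a, GRing.comm l a) ->
  sl2_triple (B ^+ 2 * T - l * B) (2%:R * B * T - l) (- T).
Proof.
move=> brTB lC.
have brBT : bracket B T = - 1 by rewrite bracketC brTB.
have brl a : bracket a l = 0 by apply/bracket_eq0/commr_sym/lC.
have brTT (a : R) : bracket a a = 0 by rewrite /bracket subrr.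
have brB : bracket (B * T) B = B.
  by rewrite bracketC bracketMr brBT brTT mul0r add0r mulrN1 opprK.
have brT : bracket (B * T) T = - T.
  by rewrite bracketC bracketMr brTB brTT mulr0 mul1r addr0.
have brH a : bracket (2%:R * B * T - l) a = bracket (B * T) a *+ 2.
  rewrite bracketBl -mulrA mulr_natl bracketMnl.
  by have /bracket_eq0-> := lC a; rewrite subr0.
split.
- rewrite brH; congr (_ *+ 2).
  rewrite bracketBr expr2 !bracketMr brB brT brl mul0r add0r.
  by rewrite mulrDl mulrN addrK.
- by rewrite brH bracketN bracketC brT mulNrn.
rewrite bracketN bracketBr expr2 !bracketMr brTB brTT brl.
by rewrite mul0r mulr0 mulr1 mul1r !add0r addr0 -mulr2n mulr_natl mulr1.
Qed.

(** With [y] = xS^-1 and [T] = S - 1 this turns the required form of H into the equation R_H +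
    lambda = 2g(S - 1), free of x S^-1. *)
Lemma mul2_split_iff (R : pzRingType) (r y g T l : R) :
  r + 2%:R * y * T = 2%:R * (y + g) * T - l <-> r + l = g *+ 2 * T.
Proof.
rewrite mulrDr mulrDl -[g *+ 2]mulr_natl [r + _]addrC -addrA.
by split=> [/addrI->|<-]; rewrite ?subrK ?addrK.
Qed.

Section ShiftAlgebra.
Variable K : fieldType.
Implicit Types (u v : shiftalg K) (p : {poly K}) (c : K) (i j : int).

(** * Coefficients of products with S^i and with polynomials *)

Lemma mcoeff_mul_SpowA u i j : (u * SpowA i)@_j = u@_(j - i).
Proof.
elim/shiftalg_ind: u => [|u v IHu IHv|p k]; first by rewrite mul0r !mcoeff0.
  by rewrite mulrDl !mcoeffD IHu IHv.
rewrite shiftalgUU -polyC1 shiftpC mulr1 !mcoeffU.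
by rewrite [k == _]eq_sym subr_eq eq_sym.
Qed.

Lemma mcoeff_SpowA_mul u i j : (SpowA i * u)@_j = shiftp i u@_(j - i).
Proof.
elim/shiftalg_ind: u => [|u v IHu IHv|p k].
- by rewrite mulr0 !mcoeff0 shiftp0.
- by rewrite mulrDr !mcoeffD shiftpD IHu IHv.
rewrite shiftalgUU mul1r !mcoeffU [k == _]eq_sym subr_eq addrC [_ == j]eq_sym.
by case: (_ == _); rewrite ?mulr0n ?mulr1n ?shiftp0.
Qed.

Lemma mcoeff_polyA_mul p u j : (polyA p * u)@_j = p * u@_j.
Proof.
elim/shiftalg_ind: u => [|u v IHu IHv|q k].
  by rewrite mulr0 !mcoeff0 mulr0.
  by rewrite mulrDr !mcoeffD mulrDr IHu IHv.
by rewrite shiftalgUU shift0p add0r !mcoeffU mulrnAr.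
Qed.

Lemma mcoeff_mul_polyA p u j : (u * polyA p)@_j = u@_j * shiftp j p.
Proof.
elim/shiftalg_ind: u => [|u v IHu IHv|q k].
  by rewrite mul0r !mcoeff0 mul0r.
  by rewrite mulrDl !mcoeffD mulrDl IHu IHv.
rewrite shiftalgUU addr0 !mcoeffU.
by case: eqP => [->|_]; rewrite ?mulr0n ?mul0r.
Qed.

(** * Constant-coefficient operators and the centralizer of S *)

Lemma SpowA_const_op i : SpowA i \is a const_op (K := K).
Proof.
by apply/const_opP => j; rewrite mcoeffU; case: eqP => _; [exists 1 | exists 0].
Qed.

Lemma scalar_const_op c : c%:A \is a const_op (K := K).
Proof.
apply/const_opP => j; rewrite shiftalg_mcoeffZ mcoeffU.
by case: eqP => _; [exists c; rewrite mulr1 | exists 0; rewrite mulr0].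
Qed.

Lemma const_op_comm : {in const_op (K := K) &, forall u v, GRing.comm u v}.
Proof.
move=> u v /const_opP hu /const_opP hv; rewrite (shiftalgE v).
apply: commr_sum => j _; apply: commrM.
  have [c ->] := hv j; rewrite polyAC /GRing.comm.
  by rewrite -scalerAl -scalerAr mul1r mulr1.
apply/malgP => k; rewrite mcoeff_mul_SpowA mcoeff_SpowA_mul.
by have [c ->] := hu (k - j); rewrite shiftpC.
Qed.

(** Periodicity gives p(n) = p(0) for every natural n. These n are distinct in characteristic zero,
    so p - p(0), if nonzero, would have as many roots as its size, one more than its degree. *)
Lemma shiftp1_fixed p : [pchar K] =i pred0 -> shiftp 1 p = p ->
  exists c, p = c%:P.
Proof.
move=> charK0 p_fix; exists p.[0]; apply/eqP; rewrite -subr_eq0.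
set q := p - _; apply: contraT => q_neq0.
have pnE n : p.[n%:R] = p.[0].
  elim: n => // n <-.
  by rewrite -[in RHS]p_fix /shiftp horner_comp !hornerE -natr1.
pose rs := [seq n%:R | n <- iota 0 (size q)] : seq K.
have rs_root : all (root q) rs.
  by apply/allP => _ /mapP[n _ ->]; rewrite /root !hornerE pnE subrr.
have rs_uniq : uniq rs.
  rewrite map_inj_uniq ?iota_uniq // => m n.
  wlog le_mn : m n / (m <= n)%N => [hw|/esym/eqP].
    by have [/hw//|/ltnW/hw h /esym/h] := leqP m n.
  have /pcharf0P natr_eq0 := charK0.
  rewrite -subr_eq0 -natrB // natr_eq0 subn_eq0 => le_nm.
  by apply/eqP; rewrite eqn_leq le_mn.
have := max_poly_roots q_neq0 rs_root rs_uniq.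
by rewrite size_map size_iota ltnn.
Qed.

(** At S^(j+1), the equation uS = Su reads u_j(x) = u_j(x + 1). *)
Lemma comm_SA_const_op u : [pchar K] =i pred0 ->
  GRing.comm u SA -> u \is a const_op.
Proof.
move=> charK0 uS; apply/const_opP => j; apply: shiftp1_fixed => //.
have /(congr1 (fun w : shiftalg K => w@_(j + 1))) := uS.
by rewrite mcoeff_mul_SpowA mcoeff_SpowA_mul addrK.
Qed.

(** * Finite support and division by S - 1 *)

Lemma mcoeff_step_eq0 u :
  (forall j, j != -1 -> u@_(j + 1) = u@_j) -> u = 0.
Proof.
move=> step; apply/malgP => j; rewrite mcoeff0.
pose N := (\max_(k <- msupp u) `|k|).+1%N.
have large k : (N <= `|k|)%N -> u@_k = 0.
  move=> Nk; apply: mcoeff_outdom; apply: contraL Nk => ku.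
  by rewrite -ltnNge ltnS (leq_bigmax_seq (F := absz) k ku).
(* No relation links the indices -1 and 0, so the two half-lines are treated apart: walk up from j
   >= 0 and down from j < 0, in both cases out of the support. *)
have [j_ge0|j_lt0] := Order.TotalTheory.leP 0 j.
  have up n : u@_(j + n%:Z) = u@_j.
    elim: n => [|n IHn]; first by rewrite addr0.
    by rewrite -IHn intS [1 + _]addrC addrA step //; lia.
  by rewrite -(up N) large //; lia.
have down n : u@_(j - n%:Z) = u@_j.
  elim: n => [|n IHn]; first by rewrite subr0.
  rewrite -IHn -step; last by lia.
  by congr (u@_ _); lia.
by rewrite -(down N) large //; lia.
Qed.

(** At S^j the equation says that u_(j-1) - u_j is c for j = 0 and 0 otherwise; the only jump
    allowed is from -1 to 0, the gap in [mcoeff_step_eq0]. Uniqueness of lambda and of g both come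
    from here. *)
Lemma mul_SA_sub1_scalar u c : u * (SA - 1) = c%:A -> u = 0 /\ c = 0.
Proof.
move=> uc; have coefE j : u@_(j - 1) - u@_j = (c *+ (0 == j))%:P.
  have := congr1 (fun w : shiftalg K => w@_j) uc.
  rewrite mulrBr mulr1 mcoeffB mcoeff_mul_SpowA shiftalg_mcoeffZ mcoeffU => ->.
  by rewrite mulrnAr mulr1 polyCMn.
have u0 : u = 0.
  apply: mcoeff_step_eq0 => j jN1; have := coefE (j + 1).
  rewrite addrK; have -> : (0 == j + 1) = false by lia.
  by rewrite mulr0n => /eqP; rewrite subr_eq0 => /eqP.
by split=> //; apply/polyC_inj; rewrite -(coefE 0) u0 !mcoeff0 subrr.
Qed.

(** For j >= 0 the factor is a geometric sum, built from S^(n+1) - 1 = S^n (S - 1) + (S^n - 1); for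
    negative exponents use S^-n - 1 = - S^-n (S^n - 1). *)
Lemma SpowA_sub1_factor j :
  exists2 q, q \is a const_op & SpowA j - 1 = q * (SA - 1) :> shiftalg K.
Proof.
have nat_factor n : exists2 q : shiftalg K, q \is a const_op &
    SpowA n%:Z - 1 = q * (SA - 1).
  elim: n => [|n [q cq qE]].
    by exists 0; [exact: rpred0 | rewrite SpowA0 subrr mul0r].
  exists (SpowA n%:Z + q); first by rewrite rpredD // SpowA_const_op.
  rewrite mulrDl -qE mulrBr mulr1 -SpowAD addrA subrK.
  by rewrite intS [1 + _]addrC.
case: j => n; first exact: nat_factor.
have [q cq qE] := nat_factor n.+1.
exists (- (SpowA (Negz n) * q)).
  by rewrite rpredN rpredM // SpowA_const_op.
rewrite mulNr -mulrA -qE mulrBr mulr1 -SpowAD NegzE addNr opprB.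
by rewrite SpowA0.
Qed.

(** Factor theorem at S = 1: [evalS 1 u] is the sum of the coefficients c_j, so the difference is
    the sum of the c_j (S^j - 1). *)
Lemma const_op_evalS_factor u : u \is a const_op ->
  exists2 q, q \is a const_op & u - (evalS 1 u)%:A = q * (SA - 1).
Proof.
move=> /const_opP cu.
have -> : u - (evalS 1 u)%:A = \sum_(j <- msupp u) (u@_j)`_0 *: (SpowA j - 1).
  rewrite {1}(shiftalgE u) /evalS /mmap scaler_suml -sumrB.
  apply: eq_bigr => j _; have [c ->] := cu j.
  by rewrite polyAC mulr_algl exp1rz mulr1 /= coefC eqxx scalerBr.
apply: (big_ind (fun w => exists2 q, q \is a const_op & w = q * (SA - 1))).
- by exists 0; [exact: rpred0 | rewrite mul0r].
- move=> _ _ [q cq ->] [r cr ->].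
  by exists (q + r); [exact: rpredD | rewrite mulrDl].
move=> j _; have [q cq ->] := SpowA_sub1_factor j.
exists (((u@_j)`_0)%:A * q); first by rewrite rpredM ?scalar_const_op.
by rewrite -mulrA mulr_algl.
Qed.

(** * Brackets with x and with S - 1 *)

Lemma intr_eq0_pchar0 j : [pchar K] =i pred0 -> (j%:~R == 0 :> K) = (j == 0).
Proof.
move=> /pcharf0P natr_eq0; case: j => n; first exact: natr_eq0.
by rewrite NegzE rmorphN /= !oppr_eq0; exact: natr_eq0.
Qed.

Lemma mulr2n_eq0_pchar0 u : [pchar K] =i pred0 -> u *+ 2 = 0 -> u = 0.
Proof.
move=> /pcharf0P natr_eq0 u2.
have two_neq0 : 2%:R != 0 :> K by rewrite natr_eq0.
by rewrite -[u]scale1r -(mulVf two_neq0) -scalerA scaler_nat u2 scaler0.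
Qed.

(** Bracketing with x multiplies the coefficient of S^k by -k, so at S^j the hypothesis is -j u_j +
    (j + 1) u_(j+1) = u_j. In characteristic zero j + 1 can be cancelled unless j = -1. *)
Lemma bracket_xA_eq0 u : [pchar K] =i pred0 ->
  bracket xA u * (1 - SVA) = u -> u = 0.
Proof.
move=> charK0 uE; apply: mcoeff_step_eq0 => j jN1.
have brE k : (bracket xA u)@_k = - (k%:~R%:P * u@_k).
  rewrite /bracket mcoeffB mcoeff_polyA_mul mcoeff_mul_polyA shiftpX.
  by rewrite mulrDr opprD ['X * _]mulrC addNKr mulrC.
have /(congr1 (fun w : shiftalg K => w@_j)) := uE.
rewrite mulrBr mulr1 mcoeffB mcoeff_mul_SpowA opprK !brE opprK.
move=> jE; apply/eqP; rewrite -subr_eq0.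
have: (j + 1)%:~R%:P * (u@_(j + 1) - u@_j) = 0.
  by rewrite mulrBr (canRL (addNKr _) jE) intrD polyCD mulrDl mul1r subrr.
move/eqP; rewrite mulf_eq0 polyC_eq0 intr_eq0_pchar0 // => /orP[|//].
by move=> /eqP j1; case/eqP: jN1; lia.
Qed.

(** This puts the base operator in the Weyl form 2BT, with g = 0 and lambda = 0. *)
Lemma two_xA_E : 2%:R * xA - 2%:R * xA * SVA =
  2%:R * (xA * SVA) * (SA - 1) :> shiftalg K.
Proof.
have expand (R : pzRingType) (n x V S : R) :
    V * S = 1 -> n * x - n * x * V = n * (x * V) * (S - 1).
  by move=> VS; rewrite mulrBr mulr1 -!mulrA VS mulr1.
exact/expand/SVA_SA.
Qed.

(** The constant part g commutes with S, and S x S^-1 - x S^-1 S = (x + 1) - x = 1. *)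
Lemma bracket_SA_xA_SVA (g : shiftalg K) : g \is a const_op ->
  bracket (SA - 1) (xA * SVA + g) = 1.
Proof.
move=> cg; have SAg : bracket SA g = 0.
  by apply/bracket_eq0/const_op_comm; rewrite ?SpowA_const_op.
have br1 a : bracket 1 a = 0 :> shiftalg K.
  by rewrite /bracket mul1r mulr1 subrr.
rewrite bracketBl br1 subr0 bracketDr SAg addr0.
rewrite /bracket -!mulrA SVA_SA mulr1 !mulrA SA_xA -mulrA SA_SVA mulr1.
by rewrite addrC addKr.
Qed.

Lemma scalar_comm c u : GRing.comm c%:A u.
Proof. by rewrite /GRing.comm mulr_algl mulr_algr. Qed.

End ShiftAlgebra.

Theorem proposition3p6 (K : fieldType) (charK0 : [pchar K] =i pred0)
    (H : shiftalg K) :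
  let F : shiftalg K := 1 - SA in
  let RH : shiftalg K := H - (2%:R * xA - 2%:R * xA * SVA) in
  ((exists E : shiftalg K, sl2_triple E H F) <-> RH \is a const_op) /\
  (RH \is a const_op ->
   exists (lambda : K) (g E : shiftalg K),
     [/\ unique (fun lg : K * shiftalg K =>
             lg.2 \is a const_op /\
             H = 2%:R * (xA * SVA + lg.2) * (SA - 1) - lg.1%:A)
           (lambda, g),
         unique (fun E' : shiftalg K => sl2_triple E' H F) E,
         lambda = - evalS 1 RH,
         const_op_quotient (RH - (evalS 1 RH)%:A) (2%:R * (SA - 1)) g &
         E = (xA * SVA + g) ^+ 2 * (SA - 1) - lambda%:A * (xA * SVA + g)]).
Proof.
move=> F RH; have FE : F = - (SA - 1) by rewrite opprB.
have HE : H = RH + 2%:R * (xA * SVA) * (SA - 1) by rewrite -two_xA_E subrK.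
have char2 (u : shiftalg K) : u *+ 2 = 0 -> u = 0 by exact: mulr2n_eq0_pchar0.
have commF (u : shiftalg K) : bracket u F = 0 -> u \is a const_op.
  rewrite bracketBr {1}/bracket mulr1 mul1r subrr sub0r => /eqP.
  by rewrite oppr_eq0 => /eqP/bracket_eq0; exact: comm_SA_const_op.
(* The parameters in [P] include a raising operator, so [P] also yields the converse half of the
   equivalence. *)
set P := (X in _ /\ (_ -> X)); suff main : RH \is a const_op -> P.
  split; last exact: main.
  split=> [[E [_ HF _]]|/main[l [g [E [_ [tE _] _ _ _]]]]]; last by exists E.
  apply: commF; rewrite /RH bracketBl HF two_xA_E.
  (* The base operator belongs to the Weyl triple with g = 0 and lambda = 0, so its bracket with F
     is -2F as well and cancels [H, F]. *)
  have c0 : (0 : shiftalg K) \is a const_op by exact: rpred0.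
  have := bracket_SA_xA_SVA K 0 c0; rewrite addr0.
  move=> /weyl_sl2_triple/(_ (fun a => commr_sym (commr0 a)))[_ + _].
  by rewrite subr0 -FE => ->; rewrite subrr.
move=> cRH; have [q cq qE] := const_op_evalS_factor K RH cRH.
set l := - evalS 1 RH; pose g := (2%:R^-1 : K)%:A * q.
have cg : g \is a const_op by rewrite rpredM ?scalar_const_op.
have g2 : g *+ 2 = q.
  rewrite /g mulr_algl -scaler_nat scalerA divff ?scale1r //.
  by have /pcharf0P-> := charK0.
have cancelT (u : shiftalg K) (c : K) :
  u *+ 2 * (SA - 1) = c%:A -> u = 0 /\ c = 0.
  by case/mul_SA_sub1_scalar => /char2.
pose B := xA * SVA + g.
have HB : H = 2%:R * B * (SA - 1) - l%:A.
  by rewrite HE; apply/mul2_split_iff; rewrite g2 -qE /l scaleNr.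
pose E := B ^+ 2 * (SA - 1) - l%:A * B.
have tE : sl2_triple E H F.
  rewrite HB FE; apply: weyl_sl2_triple; first exact: bracket_SA_xA_SVA.
  exact: scalar_comm.
exists l, g, E; split; [| | by [] | | by []].
- split=> [|[l' g'] /= [cg' H']]; first by split.
  (* Subtracting the two equations R_H + lambda = 2g(S - 1) leaves 2(g - g')(S - 1) = lambda -
     lambda'. *)
  have [|/subr0_eq-> /subr0_eq->//] := cancelT (g - g') (l - l').
  move: H' HB; rewrite HE => /mul2_split_iff g'E /mul2_split_iff gE.
  by rewrite mulrnBl mulrBl scalerBl -g'E -gE opprD addrACA subrr add0r.
- split=> // E' tE'; apply/eqP; rewrite -subr_eq0; apply/eqP.
  set D := E - E'.
  have [[HE1 _ EF] [HE1' _ EF']] := (tE, tE').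
  have cD : D \is a const_op by apply: commF; rewrite bracketBl EF EF' subrr.
  have HD : bracket H D = D *+ 2 by rewrite bracketBr HE1 HE1' -mulrnBl.
  apply: (bracket_xA_eq0 K _ charK0). apply: subr0_eq. apply: char2.
  (* [D] commutes with all of K[S, S^-1]. Hence R_H drops out of [H, D] = 2D and 1 - S^-1 can be
     moved out of the bracket, which leaves 2 [x, D] (1 - S^-1) = 2D. *)
  have comm0 u : u \is a const_op -> bracket u D = 0.
    by move=> cu; apply/bracket_eq0/const_op_comm.
  have -> : bracket xA D * (1 - SVA) = bracket (xA * (1 - SVA)) D.
    rewrite [RHS]bracketMl (comm0 (1 - SVA)); first by rewrite mulr0 add0r.
    by apply: rpredB; [exact: rpred1 | exact: SpowA_const_op].
  have /eqP := comm0 _ cRH; rewrite /RH bracketBl HD -mulrA -mulrBr mulr_natl.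
  rewrite -{1}[xA]mulr1 -mulrBr bracketMnl -mulrnBl -oppr_eq0 -mulNrn opprB.
  by move/eqP.
- have mul2E (u : shiftalg K) : u * (2%:R * (SA - 1)) = u *+ 2 * (SA - 1).
    by rewrite mulr_natl mulrnAr -mulrnAl.
  split=> [|r [_ rE]]; first by split; [exact: cg | rewrite mul2E g2 -qE].
  (* This is [cancelT] with scalar 0; the equation [0 = 0] only gives the goal the shape of its
     conclusion. *)
  suff [/subr0_eq] : g - r = 0 /\ 0 = 0 :> K by [].
  by apply: cancelT; rewrite mulrnBl mulrBl g2 -qE -rE mul2E subrr scale0r.
Qed.
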